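(* Let $n\ge1$ be an integer and $\beta$ a complex number, and define the polynomial $Q_n(x)$ by $$\frac{Q_n(x)}{(1-x)^{2n+1}}=\sum_{m\ge0}\frac{m}{m+\beta n}\binom{m+\beta n}{n}[m+1]_n\,x^m .$$ Then $$Q_n(x)=\frac{(n+1)!}{n}\sum_{m=1}^{n}\binom{n(2-\beta)}{m-1}\binom{n\beta}{n-m}x^m .$$
   Context: $[\varphi]_k=\varphi(\varphi+1)\cdots(\varphi+k-1)$ is the rising factorial, so $[m+1]_n=(m+n)!/m!$. $\binom{c}{k}=c(c-1)\cdots(c-k+1)/k!$ for complex $c$. The coefficient $\frac{m}{m+\beta n}\binom{m+\beta n}{n}$ is understood as the polynomial expression $\frac{m}{n}\binom{m+n\beta-1}{n-1}$ in $m$. The left-hand series is the $n$th descending diagonal of the exponential Riordan array $(1,x\,{}_{(\beta)}a(x))_{e^x}$ for the generalized binomial series ${}_{(\beta)}a(x)$. *)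

(* Defs.v *)
From mathcomp Require Import all_boot all_order all_algebra.
From mathcomp Require Import reals.
From mathcomp Require Export complex.

Set Implicit Arguments.
Unset Strict Implicit.
Unset Printing Implicit Defensive.

Import GRing.Theory.
Local Open Scope ring_scope.

(* [phi]_k = phi (phi + 1) ... (phi + k - 1) *)
Definition rising (F : fieldType) (phi : F) (k : nat) : F :=
  \prod_(i < k) (phi + i%:R).

(* c (c - 1) ... (c - k + 1) / k! *)
Definition gbinom (F : fieldType) (c : F) (k : nat) : F :=
  (\prod_(i < k) (c - i%:R)) / (k`!)%:R.

(* m / (m + beta n) * binom (m + beta n) n as a polynomial expression in m,
   so that the value at m + beta n = 0 is the polynomial one
   (see diag_coefE).  Meant for 0 < n. *)
Definition diag_coef (F : fieldType) (beta : F) (n m : nat) : F :=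
  m%:R / n%:R * gbinom (m%:R + n%:R * beta - 1) n.-1.

(* The formal power series \sum_k (f k) x^k is encoded by f : nat -> F. *)
Definition fps_poly (F : fieldType) (p : {poly F}) : nat -> F := fun k => p`_k.

Definition fps_mul (F : fieldType) (f g : nat -> F) : nat -> F :=
  fun k => \sum_(i < k.+1) f i * g (k - i)%N.

(* The first k coefficients of 1 / f, from the recursion
   f 0 * g j = (j == 0) - \sum_(i < j) f (j - i) * g i. *)
Fixpoint fps_inv_prefix (F : fieldType) (f : nat -> F) (k : nat) : seq F :=
  if k is j.+1 then
    let s := fps_inv_prefix f j in
    rcons s (((j == 0%N)%:R - \sum_(i < j) f (j - i)%N * s`_i) / f 0%N)
  else [::].

(* Meaningful when f 0 != 0 (see fps_mulV). *)
Definition fps_inv (F : fieldType) (f : nat -> F) : nat -> F :=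
  fun k => (fps_inv_prefix f k.+1)`_k.

Definition fps_div (F : fieldType) (f g : nat -> F) : nat -> F :=
  fps_mul f (fps_inv g).

Lemma size_fps_inv_prefix (F : fieldType) (f : nat -> F) k :
  size (fps_inv_prefix f k) = k.
Proof. by elim: k => //= k IH; rewrite size_rcons IH. Qed.

Lemma nth_fps_inv_prefix (F : fieldType) (f : nat -> F) k i :
  (i < k)%N -> (fps_inv_prefix f k)`_i = fps_inv f i.
Proof.
elim: k => // k IH; rewrite ltnS leq_eqVlt => /orP[/eqP-> //|lt_ik].
by rewrite /= nth_rcons size_fps_inv_prefix lt_ik IH.
Qed.

Lemma fps_mulV (F : fieldType) (f : nat -> F) :
  f 0%N != 0 -> fps_mul f (fps_inv f) =1 fps_poly 1.
Proof.
move=> f0 k; rewrite /fps_mul /fps_poly coef1 big_ord_recl subn0.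
rewrite {1}/fps_inv /= nth_rcons size_fps_inv_prefix ltnn eqxx.
rewrite mulrC divfK // -addrA [X in _ + X](_ : _ = 0) ?addr0 //.
rewrite addrC; apply/eqP; rewrite subr_eq0; apply/eqP.
rewrite (reindex_inj rev_ord_inj) /=; apply: eq_bigr => i _.
have lt_ik := ltn_ord i.
rewrite nth_fps_inv_prefix // /bump /= add1n subnSK //.
by rewrite subKn // ltnW.
Qed.

Lemma diag_coefE (F : fieldType) (beta : F) (n m : nat) :
  (0 < n)%N -> m%:R + beta * n%:R != 0 ->
  diag_coef beta n m =
  m%:R / (m%:R + beta * n%:R) * gbinom (m%:R + beta * n%:R) n.
Proof.
case: n => // n _; rewrite /diag_coef /gbinom /= [n.+1%:R * _]mulrC.
set z := (_ + _) => z0; rewrite big_ord_recl subr0 factS natrM invfM.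
have -> : \prod_(i < n) (z - (lift ord0 i)%:R) =
         \prod_(i < n) (z - 1 - i%:R).
  by apply: eq_bigr => i _; rewrite lift0 -nat1r opprD addrA.
by rewrite -!mulrA mulKf //; congr (_ * _); rewrite mulrCA.
Qed.

(* Main.v *)
Require Import Defs.
From mathcomp Require Import all_boot all_order all_algebra.
From mathcomp Require Import reals.
From mathcomp Require Import ring zify.
Set Implicit Arguments.
Unset Strict Implicit.
Unset Printing Implicit Defensive.

Import GRing.Theory.
Local Open Scope ring_scope.

(** Since 1 / (1 - x)^(2n+1) is the generating function of the binomials
    C(2n+k, 2n), the claim amounts to an identity between polynomials in m.
    After removing the common factor m (m+1) ... (m+n) it becomes the
    Pfaff-Saalschuetz summation, which in terms of falling factorials c^_k reads
      \sum_k C(N,k) a^_k b^_(N-k) y^_k (a+b+y-k)^_(N-k) = (a+b)^_N (b+y)^_N,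
    taken at N = n - 1, a = n (2 - beta), b = n beta and y = m - 1. *)

(** * Falling factorials and the Pfaff-Saalschuetz summation *)

Definition falling {R : comNzRingType} (c : R) (k : nat) : R :=
  \prod_(i < k) (c - i%:R).

Definition saalschutz_sum {R : comNzRingType} (N : nat) (a b y : R) : R :=
  \sum_(k < N.+1) 'C(N, k)%:R * falling a k * falling b (N - k)
    * falling y k * falling (a + b + y - k%:R) (N - k).

Section Falling.
Variable R : comNzRingType.
Implicit Types (a b c y : R) (k l N : nat).

Lemma falling0 c : falling c 0 = 1.
Proof. by rewrite /falling big_ord0. Qed.

Lemma fallingSr c k : falling c k.+1 = falling c k * (c - k%:R).
Proof. by rewrite /falling big_ord_recr. Qed.

Lemma fallingD c k l :
  falling c (k + l) = falling c k * falling (c - k%:R) l.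
Proof.
elim: l => [|l IHl]; first by rewrite addn0 falling0 mulr1.
by rewrite addnS !fallingSr IHl natrD -mulrA; congr (_ * (_ * _)); ring.
Qed.

Lemma fallingS c k : falling c k.+1 = c * falling (c - 1) k.
Proof. by rewrite -add1n fallingD fallingSr falling0 mul1r subr0. Qed.

Lemma falling_sub1 c k :
  falling c k - falling (c - 1) k = k%:R * falling (c - 1) k.-1.
Proof.
case: k => [|k]; first by rewrite !falling0 subrr mul0r.
by rewrite fallingS fallingSr /= -natr1; ring.
Qed.

Lemma natr_ffact (m k : nat) : (m ^_ k)%:R = falling (m%:R : R) k.
Proof.
elim: k m => [|k IHk] [|m]; rewrite ?falling0 //.
  by rewrite fallingS mul0r.
by rewrite ffactSS natrM IHk fallingS -natr1 addrK.
Qed.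

(** This recurrence drives the induction in [saalschutz]: it lowers the order at the price of
    shifting b to b - 1. Pascal's rule gives every summand a common factor [t k] times a quadratic
    in k whose k^2 terms cancel. *)
Lemma saalschutz_sumSS N a b y :
  saalschutz_sum N.+2 a b y =
  (a + b - N.+1%:R) * (b + y - N.+1%:R) *
    (saalschutz_sum N.+1 a b y - N.+1%:R * b * saalschutz_sum N a (b - 1) y)
  + N.+1%:R * b * saalschutz_sum N.+1 a (b - 1) y.
Proof.
pose M := N.+1.
pose t k := 'C(M, k)%:R * falling a k * falling b (M - k)
    * falling y k * falling (a + b + y - k%:R - 1) (M - k).
have splitS : saalschutz_sum M.+1 a b y =
  \sum_(k < M.+1) t k *
    ((b - (M - k)%:R) * (a + b + y - k%:R) + (a - k%:R) * (y - k%:R)).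
  pose f k := falling a k * falling b (M.+1 - k)
    * falling y k * falling (a + b + y - k%:R) (M.+1 - k).
  have -> : saalschutz_sum M.+1 a b y = \sum_(k < M.+2) 'C(M.+1, k)%:R * f k.
    by apply: eq_bigr => k _; rewrite /f !mulrA.
  have -> : \sum_(k < M.+2) 'C(M.+1, k)%:R * f k =
      \sum_(k < M.+1) 'C(M, k)%:R * f k + \sum_(k < M.+1) 'C(M, k)%:R * f k.+1.
    rewrite big_ord_recl; under eq_bigr do
      rewrite lift0 binS natrD mulrDl.
    rewrite big_split /= addrA; congr (_ + _).
    rewrite big_ord_recr /= (bin_small (ltnSn M)) mul0r addr0.
    by rewrite [RHS]big_ord_recl !bin0.
  rewrite -big_split; apply: eq_bigr => k _ /=.
  have leM : (k <= M)%N by exact: leq_ord.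
  rewrite /f /t subSS subSn // (fallingSr a) (fallingSr b) (fallingSr y).
  rewrite (fallingS (a + b + y - k%:R)).
  have -> : a + b + y - k.+1%:R = a + b + y - k%:R - 1 by rewrite -natr1; ring.
  ring.
have sum_t : \sum_(k < M.+1) t k =
    saalschutz_sum M a b y - M%:R * b * saalschutz_sum N a (b - 1) y.
  (* The last factor of [t k] starts one lower than in the sum of order M. By [falling_sub1] the
     defect is a falling factorial of length M - k - 1, and C(M,k) (M-k) = M C(N,k) turns it into a
     sum of order N at b - 1. *)
  have -> : M%:R * b * saalschutz_sum N a (b - 1) y = \sum_(k < M.+1)
    'C(M, k)%:R * falling a k * falling b (M - k) * falling y k
    * ((M - k)%:R * falling (a + b + y - k%:R - 1) (M - k).-1).
    rewrite big_ord_recr /= subnn mulr0n mul0r mulr0 addr0 mulr_sumr.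
    apply: eq_bigr => k _.
    have leN : (k <= N)%N by exact: leq_ord.
    have -> : a + (b - 1) + y - k%:R = a + b + y - k%:R - 1 by ring.
    have binE : 'C(M, k)%:R * (M - k)%:R = M%:R * 'C(N, k)%:R :> R.
      by rewrite -!natrM mulnC -mul_bin_down.
    transitivity ('C(M, k)%:R * (M - k)%:R
      * falling a k * falling b (M - k) * falling y k
      * falling (a + b + y - k%:R - 1) (M - k).-1); last by ring.
    rewrite binE /M subSn // fallingS /=; ring.
  rewrite -sumrB; apply: eq_bigr => k _.
  by rewrite -falling_sub1 /t; ring.
rewrite splitS -/M -sum_t !mulr_sumr -big_split /=.
apply: eq_bigr => k _.
have leM : (k <= M)%N by exact: leq_ord.
have -> : a + (b - 1) + y - k%:R = a + b + y - k%:R - 1 by ring.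
have bE : b * falling (b - 1) (M - k) = falling b (M - k) * (b - (M - k)%:R).
  by rewrite -fallingS fallingSr.
(* The quadratic left by Pascal's rule equals (a+b-M)(b+y-M) + M (b-(M-k)); by [bE] its second term
   yields the sum at b - 1. *)
transitivity ((a + b - M%:R) * (b + y - M%:R) * t k + M%:R *
   ('C(M, k)%:R * falling a k * (b * falling (b - 1) (M - k)) * falling y k *
      falling (a + b + y - k%:R - 1) (M - k))); last by ring.
by rewrite bE /t natrB //; ring.
Qed.

Theorem saalschutz N a b y :
  saalschutz_sum N a b y = falling (a + b) N * falling (b + y) N.
Proof.
(* The recurrence reaches two orders back and changes b, so the induction carries two consecutive
   orders, each for all b. *)
have [P0 P1] : (forall b, saalschutz_sum N a b y
                = falling (a + b) N * falling (b + y) N)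
  /\ (forall b, saalschutz_sum N.+1 a b y
                = falling (a + b) N.+1 * falling (b + y) N.+1); last exact: P0.
elim: N {b} => [|N [IH0 IH1]]; split=> b //.
- by rewrite /saalschutz_sum big_ord1 /= !falling0 !mulr1.
- rewrite /saalschutz_sum !big_ord_recr big_ord0 /= subn0 subnn.
  rewrite !fallingSr !falling0 bin0 binn; ring.
rewrite saalschutz_sumSS IH0 !IH1 -natr1.
rewrite [falling _ N.+2]fallingSr [falling (b + y) N.+2]fallingSr.
rewrite [falling (a + (b - 1)) N.+1]fallingSr.
rewrite [falling (b - 1 + y) N.+1]fallingSr -natr1; ring.
Qed.

End Falling.

(** * Power series: cancellation and the expansion of 1 / (1 - x)^(d+1) *)

Section PowerSeries.
Variable F : fieldType.
Implicit Types (f g h : nat -> F) (p : {poly F}).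

Lemma fps_mulC f g : fps_mul f g =1 fps_mul g f.
Proof.
move=> k; rewrite /fps_mul (reindex_inj rev_ord_inj) /=.
by apply: eq_bigr => i _; rewrite subSS subKn ?leq_ord // mulrC.
Qed.

Lemma fps_mulIr g f h : g 0%N != 0 -> fps_mul f g =1 fps_mul h g -> f =1 h.
Proof.
move=> g0 eq_fg k; have [m] := ubnP k; elim: m k => // m IHm k lt_km.
have := eq_fg k; rewrite /fps_mul !big_ord_recr /= subnn.
rewrite (eq_bigr (fun i : 'I_k => h i * g (k - i)%N)).
  by move/addrI/(mulIf g0).
by move=> i _; rewrite IHm // (leq_trans (ltn_ord i)).
Qed.

Lemma fps_inv0 f : fps_inv f 0 = (f 0%N)^-1.
Proof. by rewrite /fps_inv /= big_ord0 subr0 div1r. Qed.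

Lemma fps_inv_unique f g :
  f 0%N != 0 -> fps_mul f g =1 fps_poly 1 -> fps_inv f =1 g.
Proof.
move=> f0 fg1; apply: (fps_mulIr f0) => k.
by rewrite !(fps_mulC _ f) fps_mulV // fg1.
Qed.

(** Moving a factor 1 - x onto the other series turns it into a backward difference, which Pascal's
    rule evaluates on binomials in [fps_inv_1BX_exp]. *)
Lemma fps_mul_1BX p g :
  fps_mul (fps_poly ((1 - 'X) * p)) g =1
  fps_mul (fps_poly p) (fun k => if k is j.+1 then g k - g j else g k).
Proof.
(* Coefficient k only sees g up to degree k, so g may be truncated to a polynomial and the product
   reassociated in {poly F}. *)
move=> k; pose G := \poly_(i < k.+1) g i.
have mulG q h (H : {poly F}) : (forall i, (i <= k)%N -> H`_i = h i) ->
    fps_mul (fps_poly q) h k = (q * H)`_k.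
  move=> HE; rewrite coefM; apply: eq_bigr => i _.
  by rewrite HE // leq_subr.
rewrite (mulG _ _ G) => [|i le_ik]; last by rewrite coef_poly ltnS le_ik.
rewrite (mulG _ _ (G * (1 - 'X))) => [|i le_ik].
  by rewrite -mulrA mulrC -mulrA.
rewrite mulrBr mulr1 coefB coefMX !coef_poly.
case: i le_ik => [|i] le_ik /=; first by rewrite subr0.
by rewrite ltnS le_ik ltnS (ltnW le_ik).
Qed.

Lemma fps_inv_1BX_exp d :
  fps_inv (fps_poly ((1 - 'X) ^+ d.+1)) =1 (fun k => 'C(d + k, d)%:R : F).
Proof.
apply: fps_inv_unique.
  by rewrite /fps_poly -horner_coef0 !hornerE subr0 expr1n oner_neq0.
elim: d => [|d IHd] k.
  rewrite expr1 -[1 - 'X]mulr1 fps_mul_1BX /fps_mul big_ord_recl big1.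
    rewrite /fps_poly subn0 !coef1 mul1r addr0.
    by case: k => [|k]; rewrite !bin0 ?subrr.
  by move=> i _; rewrite /fps_poly coef1 mul0r.
rewrite exprS fps_mul_1BX -IHd; apply: eq_bigr => i _; congr (_ * _).
case: (k - i)%N => [|j]; first by rewrite !addn0 !binn.
by rewrite addSn binS addSnnS natrD addrAC subrr add0r.
Qed.

End PowerSeries.

(** * Comparison of coefficients *)

Lemma diag_coef_risingE (F : numFieldType) (N m : nat) (beta : F) :
  diag_coef beta N.+1 m * rising (m%:R + 1) N.+1 =
  falling (m%:R + N.+1%:R) N.+2 * falling (N.+1%:R * beta + (m%:R - 1)) N
  / N.+1`!%:R.
Proof.
have -> : falling (m%:R + N.+1%:R) N.+2 = rising (m%:R + 1) N.+1 * (m%:R : F).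
  rewrite fallingSr addrK; congr (_ * _).
  rewrite /rising (reindex_inj rev_ord_inj) /=; apply: eq_bigr => i _.
  by rewrite subSS natrB ?leq_ord // -natr1; ring.
rewrite /diag_coef /gbinom -/(falling _ _) factS natrM /=.
have -> : m%:R + N.+1%:R * beta - 1 = N.+1%:R * beta + (m%:R - 1) by ring.
rewrite invfM; ring.
Qed.

(** With n = N + 1, the three products run over adjacent ranges: m+n down to m, m-1 down to m-k, and
    2n+m-k-1 down to m+n+1. Together they are 2n consecutive factors. *)
Lemma falling_window (F : numFieldType) (N m k : nat) : (k <= N)%N ->
  falling (m%:R + N.+1%:R : F) N.+2
  * falling (m%:R - 1) k
  * falling (2%:R * N.+1%:R + (m%:R - 1) - k%:R) (N - k)
  = (2 * N.+1)`!%:R * 'C(2 * N.+1 + m - k.+1, 2 * N.+1)%:R.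
Proof.
move=> le_kN; rewrite [RHS]mulrC -(natrM _ 'C(_, _)) bin_ffact natr_ffact.
set z := 2%:R * N.+1%:R + (m%:R - 1) - k%:R.
have -> : (2 * N.+1 + m - k.+1)%:R = z.
  by rewrite natrB; [rewrite natrD natrM -[k.+1%:R]natr1 /z; ring | lia].
have -> : (2 * N.+1 = (N - k) + (N.+2 + k))%N by lia.
rewrite !fallingD natrB //.
have -> : z - (N%:R - k%:R) = m%:R + N.+1%:R by rewrite /z -natr1; ring.
have -> : m%:R + N.+1%:R - N.+2%:R = m%:R - 1 :> F.
  by rewrite -[N.+2%:R]natr1; ring.
exact: mulrC.
Qed.

(** The conditional guards against truncated subtraction: for m <= j, m - j.+1 is 0 and would
    wrongly pick up g 0. *)
Lemma fps_mul_sumX (F : fieldType) (n : nat) (c : F) (q g : nat -> F) (m : nat) :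
  fps_mul (fps_poly (c *: \sum_(1 <= j < n.+1) q j *: 'X^j)) g m =
  c * \sum_(j < n) q j.+1 * (if (j < m)%N then g (m - j.+1)%N else 0).
Proof.
rewrite big_add1 big_mkord /= /fps_mul /fps_poly.
under [LHS] eq_bigr do rewrite coefZ coef_sum -mulrA mulr_suml.
rewrite -mulr_sumr exchange_big /=; congr (_ * _); apply: eq_bigr => j _.
under [LHS] eq_bigr do rewrite coefZ coefXn -mulrA.
rewrite -mulr_sumr; congr (_ * _).
under [LHS] eq_bigr do rewrite mulr_natl mulrb.
rewrite -big_mkcond /=.
case: ifPn => [lt_jm|]; first by rewrite (big_pred1 (Ordinal (lt_jm : (j.+1 < m.+1)%N))).
by move=> ge_jm; rewrite big_pred0 // => i; apply/eqP => ij; have := ltn_ord i; lia.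
Qed.

Lemma diag_series_numerator (F : numFieldType) (n m : nat) (beta : F) :
  (0 < n)%N ->
  fps_div
    (fps_poly (((n.+1)`!%:R / n%:R) *: \sum_(1 <= j < n.+1)
       (gbinom (n%:R * (2%:R - beta)) j.-1 * gbinom (n%:R * beta) (n - j))
          *: 'X^j))
    (fps_poly ((1 - 'X) ^+ (2 * n + 1))) m =
  diag_coef beta n m * rising (m%:R + 1) n.
Proof.
case: n => // N _.
have natf_neq0 k : (k`!)%:R != 0 :> F by rewrite Num.Theory.pnatr_eq0 -lt0n fact_gt0.
have n0 : N.+1%:R != 0 :> F by rewrite Num.Theory.pnatr_eq0.
rewrite addn1 /fps_div.
rewrite (_ : fps_mul _ _ m = fps_mul (fps_poly (((N.+2)`!%:R / N.+1%:R) *: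
     \sum_(1 <= j < N.+2)
       (gbinom (N.+1%:R * (2%:R - beta)) j.-1 * gbinom (N.+1%:R * beta) (N.+1 - j))
          *: 'X^j)) (fun k => 'C(2 * N.+1 + k, 2 * N.+1)%:R) m); last first.
  by apply: eq_bigr => i _; rewrite fps_inv_1BX_exp.
rewrite fps_mul_sumX diag_coef_risingE.
set a := N.+1%:R * (2%:R - beta); set b := N.+1%:R * beta.
have abE : a + b = 2%:R * N.+1%:R by rewrite /a /b; ring.
have := saalschutz N a b (m%:R - 1); rewrite abE => sumE.
have fact2n : falling (2%:R * N.+1%:R : F) N * N.+2`!%:R = (2 * N.+1)`!%:R.
  rewrite -natrM -natr_ffact -natrM.
  by rewrite (_ : N.+2 = (2 * N.+1 - N)%N) ?ffact_fact //; lia.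
(* Since a + b = 2n does not involve beta, (b+y)^_N is the Saalschuetz sum divided by the constant
   (2n)^_N = (2n)!/(n+1)!, nonzero in characteristic 0. The two sides can now be compared term by
   term. *)
have -> : falling (m%:R + N.+1%:R) N.+2 * falling (b + (m%:R - 1)) N / N.+1`!%:R =
   N.+2`!%:R / (2 * N.+1)`!%:R / N.+1`!%:R * (falling (m%:R + N.+1%:R) N.+2
     * saalschutz_sum N a b (m%:R - 1)).
  rewrite sumE -fact2n.
  have : falling (2%:R * N.+1%:R : F) N != 0.
    by have := natf_neq0 (2 * N.+1)%N; rewrite -fact2n mulf_eq0 negb_or => /andP[].
  by move=> ?; field; rewrite !natf_neq0.
rewrite /saalschutz_sum abE !mulr_sumr; apply: eq_bigr => k _.
have le_kN : (k <= N)%N by exact: leq_ord.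
(* For m <= k the upper index 2n+m-k-1 is below 2n, so the binomial vanishes by itself. *)
have -> : (if (k < m)%N then 'C(2 * N.+1 + (m - k.+1), 2 * N.+1)%:R else 0) =
          'C(2 * N.+1 + m - k.+1, 2 * N.+1)%:R :> F.
  case: ifPn => [lt_km|]; first by rewrite addnBA.
  by move=> ge_km; rewrite bin_small //; lia.
have -> : 'C(2 * N.+1 + m - k.+1, 2 * N.+1)%:R =
    falling (m%:R + N.+1%:R : F) N.+2 * falling (m%:R - 1) k
    * falling (2%:R * N.+1%:R + (m%:R - 1) - k%:R) (N - k) / (2 * N.+1)`!%:R.
  by rewrite falling_window // mulrC mulKf.
rewrite /gbinom -/(falling a k) subSS -/(falling b (N - k)) /=.
have binE : 'C(N, k)%:R * (k`!%:R * (N - k)`!%:R) = N`!%:R :> F.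
  by rewrite -!natrM bin_fact.
rewrite factS [(N.+1 * _)%:R]natrM -binE.
have bin_neq0 : 'C(N, k)%:R != 0 :> F
  by rewrite Num.Theory.pnatr_eq0 -lt0n bin_gt0.
by field; rewrite nat1r !natf_neq0 bin_neq0 n0.
Qed.

Theorem theorem8 (R : realType) (n : nat) (beta : R[i]) (Q : {poly R[i]}) :
  (1 <= n)%N ->
  fps_div (fps_poly Q) (fps_poly ((1 - 'X) ^+ (2 * n + 1)))
    =1 (fun m : nat => diag_coef beta n m * rising (m%:R + 1) n)
  <->
  Q = ((n.+1)`!%:R / n%:R) *:
      \sum_(1 <= m < n.+1)
        (gbinom (n%:R * (2%:R - beta)) m.-1 * gbinom (n%:R * beta) (n - m))
          *: 'X^m.
Proof.
move=> n_gt0; split=> [QE|-> m]; last exact: diag_series_numerator.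
(* The inverse power of 1 - x has constant term 1, so multiplication by it is injective and the
   series determines Q. *)
apply/polyP; apply: (@fps_mulIr _ (fps_inv (fps_poly ((1 - 'X) ^+ (2 * n + 1))))).
  by rewrite addn1 fps_inv_1BX_exp addn0 binn oner_neq0.
by move=> m; rewrite -[LHS]/(fps_div _ _ m) QE -diag_series_numerator.
Qed.
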